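(* Consider the one-dimensional nonnegative spline smoothing problem, i.e. the convex semi-infinite program $$\text{(P)}\qquad \min_{\bm b\in\mathbb R^{dm+1}} f(\bm b):=\lVert \bm y-\bm A\bm b\rVert_2^2+\lambda\,\bm b^{\mathrm T}\bm Q\bm b\quad\text{subject to}\quad \bm g_\tau^{\mathrm T}\bm b_{\langle i\rangle}\ge 0\ \ \forall \tau\in[0,1],\ i=1,\dots,m,\quad \bm H\bm b=\bm 0,$$ with $\bm y,\bm A,\bm Q,\bm H,\bm g_\tau,\bm b_{\langle i\rangle},\lambda$ as defined in the context, and let $\bm b^*$ be its unique optimal solution. Let $\bm b_r$ ($r=0,1,2,\dots$) be the coefficient vectors generated in Step (ii) of the cutting-plane algorithm described in the context, applied to (P). Let $\mathcal N_{\bm H}:=\{\bm b\in\mathbb R^{dm+1}\mid \bm H\bm b=\bm 0\}$, let $\bm P_{\mathcal N_{\bm H}}$ be the matrix of the orthogonal projection onto $\mathcal N_{\bm H}$, and let $\gamma$ be the smallest positive eigenvalue of the Riemannian Hessian of $f$ on $\mathcal N_{\bm H}$, i.e. of the constant matrix $2\bm P_{\mathcal N_{\bm H}}(\bm A^{\mathrm T}\bm A+\lambda\bm Q)\bm P_{\mathcal N_{\bm H}}$. Then for every $r$ for which $\bm b_r$ is generated, $$\lVert\bm b^*-\bm b_r\rVert_2^2\le\frac{2}{\gamma}\bigl(f(\bm b^* )-f(\bm b_r)\bigr).$$ Moreover, put $g_i(\bm b,\tau):=-\bm g_\tau^{\mathrm T}\bm b_{\langle i\rangle}$ and $\phi_i(\bm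 b):=\max_{\tau\in[0,1]}g_i(\bm b,\tau)$. If there is $\delta\in[0,1)$ such that the points $\tau_{i,r}\in[0,1]$ computed in Step (iii) satisfy $$\phi_i(\bm b_r)-\delta\,|\phi_i(\bm b_r)|\le g_i(\bm b_r,\tau_{i,r})\le\phi_i(\bm b_r)$$ for all $i=1,\dots,m$ and all $r$, then the convergence rate is at least $\lVert\bm b^*-\bm b_r\rVert_2^2=\mathcal O(1/r)$, i.e. there is a constant $C\ge 0$ independent of $r$ such that $\lVert\bm b^*-\bm b_r\rVert_2^2\le C/r$ for every $r\ge1$ for which $\bm b_r$ is generated.
   Context: **Setting.** Let $m\ge1$, $d\ge 3$ and $n\ge 1$ be integers, $\xi_0<\xi_1<\dots<\xi_m$ real knots, $\Delta_i:=\xi_i-\xi_{i-1}$, and let $\{(x_j,y_j)\}_{j=0}^n$ be data points with $x_0<x_1<\dots<x_n$, $[x_0,x_n]\subset[\xi_0,\xi_m]$ and $y_j\ge0$. Let $\lambda>0$ and $\bm y:=(y_0,\dots,y_n)^{\mathrm T}$. **Coefficients and pieces.** A vector $\bm b=(b_0,b_1,\dots,b_{dm})^{\mathrm T}\in\mathbb R^{dm+1}$ encodes a continuous piecewise polynomial $s$ on $[\xi_0,\xi_m]$ by $s=p_i$ on $[\xi_{i-1},\xi_i]$ ($i=1,\dots,m$), where, with $\tau=(x-\xi_{i-1})/\Delta_i\in[0,1]$, $$p_i(x)=\sum_{k=0}^d b_{d(i-1)+k}\,\frac{d!}{(d-k)!\,k!}(1-\tau)^{d-k}\tau^k=\bm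 g_\tau^{\mathrm T}\bm b_{\langle i\rangle},$$ $\bm b_{\langle i\rangle}:=(b_{d(i-1)},b_{d(i-1)+1},\dots,b_{di})^{\mathrm T}\in\mathbb R^{d+1}$, and $\bm g_\tau\in\mathbb R^{d+1}$ is the vector with entries $\frac{d!}{(d-k)!\,k!}(1-\tau)^{d-k}\tau^k$, $k=0,\dots,d$. **Matrices.** - $\bm A\in\mathbb R^{(n+1)\times(dm+1)}$ is the matrix with $\bm A\bm b=(s(x_0),\dots,s(x_n))^{\mathrm T}$ for all $\bm b$. - $\bm Q\in\mathbb R^{(dm+1)\times(dm+1)}$ is the symmetric positive semidefinite matrix with $\bm b^{\mathrm T}\bm Q\bm b=\sum_{i=1}^m\int_{\xi_{i-1}}^{\xi_i}|p_i''(x)|^2\,\mathrm dx$ for all $\bm b$. - $\bm H\in\mathbb R^{(2m-2)\times(dm+1)}$ is the matrix for which $\bm H\bm b=\bm 0$ is the system of linear equations $$\frac1{\Delta_i^l}\sum_{k=0}^l\frac{(-1)^{l-k}l!}{(l-k)!\,k!}b_{di+k-l}-\frac1{\Delta_{i+1}^l}\sum_{k=0}^l\frac{(-1)^{l-k}l!}{(l-k)!\,k!}b_{di+k}=0\qquad(l=1,2;\ i=1,\dots,m-1),$$ which is equivalent to $s\in C^2$ on $[\xi_0,\xi_m]$. **Cutting-plane algorithm.** - (i) Fix a tolerance $\epsilon\ge0$, set $\widetilde T_{i,0}:=\varnothing$ for $i=1,\dots,m$, and $r=0$. - (ii) Let $\bm b_r$ be the unique solution of the quadratic program: minimize $f(\bm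 b)$ over $\bm b\in\mathbb R^{dm+1}$ subject to $\bm g_\tau^{\mathrm T}\bm b_{\langle i\rangle}\ge0$ for all $\tau\in\widetilde T_{i,r}$, $i=1,\dots,m$, and $\bm H\bm b=\bm 0$. - (iii) For each $i$, compute a point $\tau_{i,r}\in[0,1]$ as an (exact or approximate) minimizer over $\tau\in[0,1]$ of the $i$th polynomial piece $\tau\mapsto\bm g_\tau^{\mathrm T}(\bm b_r)_{\langle i\rangle}$, equivalently a maximizer of $g_i(\bm b_r,\cdot)=-\bm g_{(\cdot)}^{\mathrm T}(\bm b_r)_{\langle i\rangle}$. No accuracy of this computation is assumed beyond what is stated in the claim. - (iv) If $g_i(\bm b_r,\tau_{i,r})\le\epsilon$ for all $i$, terminate and return $\bm b_r$. Otherwise, for each $i$ set $\widetilde T_{i,r+1}:=\widetilde T_{i,r}\cup\{\tau_{i,r}\}$ if $g_i(\bm b_r,\tau_{i,r})>\epsilon$ and $\widetilde T_{i,r+1}:=\widetilde T_{i,r}$ otherwise; increase $r$ by $1$ and go to (ii). *)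

(* Defs.v *)
From HB Require Import structures.
From mathcomp Require Import all_boot all_order all_algebra.
From mathcomp Require Import all_classical all_reals all_analysis.
Set Implicit Arguments.
Unset Strict Implicit.
Unset Printing Implicit Defensive.
Import Order.TTheory GRing.Theory Num.Theory.
Import numFieldNormedType.Exports.
Local Open Scope classical_set_scope.
Local Open Scope ring_scope.

(* MathComp / MathComp-Analysis development over an abstract R : realType.
   The pieces of the spline are numbered i = 1, ..., m; a family indexed by
   pieces or knots is a function on nat whose values out of range are
   irrelevant. *)

Definition dot (R : realType) (N : nat) (u v : 'cV[R]_N) : R :=
  (u^T *m v) 0 0.

(* The norm `|v| that MathComp-Analysis puts on matrices is the sup norm, so
   the squared Euclidean norm needs its own name. *)
Definition sqnorm2 (R : realType) (N : nat) (v : 'cV[R]_N) : R :=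
  \sum_(k < N) v k 0 ^+ 2.

Definition is_minimizer (R : realType) (T : Type) (f : T -> R) (S : set T)
    (b : T) : Prop :=
  S b /\ forall b', S b' -> f b <= f b'.

Definition coef (R : realType) (d m : nat) (b : 'cV[R]_(d * m).+1) (k : nat)
    : R :=
  b (inord k) 0.

Definition gap (R : realType) (xi : nat -> R) (i : nat) : R :=
  xi i - xi i.-1.

Definition gvec (R : realType) (d : nat) (tau : R) : 'cV[R]_d.+1 :=
  \col_(k < d.+1) ('C(d, k)%:R * (1 - tau) ^+ (d - k) * tau ^+ k).

Definition block (R : realType) (d m : nat) (b : 'cV[R]_(d * m).+1) (i : nat)
    : 'cV[R]_d.+1 :=
  \col_(k < d.+1) coef b (d * i.-1 + k).

(* The polynomial p_i, as a function on the whole line. *)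
Definition piece (R : realType) (d m : nat) (xi : nat -> R)
    (b : 'cV[R]_(d * m).+1) (i : nat) (t : R) : R :=
  dot (gvec d ((t - xi i.-1) / gap xi i)) (block b i).

(* A b = (s(x_0), ..., s(x_n))^T, where s = p_i on [xi_(i-1), xi_i]; at an
   interior knot the two adjacent pieces share the coefficient b_(d i). *)
Definition is_evaluation_mx (R : realType) (d m n : nat) (xi : nat -> R)
    (x : 'I_n.+1 -> R) (A : 'M[R]_(n.+1, (d * m).+1)) : Prop :=
  forall (b : 'cV[R]_(d * m).+1) (j : 'I_n.+1) (i : nat),
    (1 <= i <= m)%N -> xi i.-1 <= x j <= xi i ->
    (A *m b) j 0 = piece xi b i (x j).

Definition is_roughness_mx (R : realType) (d m : nat) (xi : nat -> R)
    (Q : 'M[R]_((d * m).+1)) : Prop :=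
  [/\ Q^T = Q,
      forall b : 'cV[R]_(d * m).+1, 0 <= dot b (Q *m b) &
      forall b : 'cV[R]_(d * m).+1,
        dot b (Q *m b) =
        \sum_(1 <= i < m.+1)
          \int[@lebesgue_measure R]_(t in `[xi i.-1, xi i])
            (`| derive1n 2 (piece xi b i) t | ^+ 2)].

Definition is_smoothness_mx (R : realType) (d m : nat) (xi : nat -> R)
    (H : 'M[R]_(2 * m - 2, (d * m).+1)) : Prop :=
  forall b : 'cV[R]_(d * m).+1,
    H *m b = 0 <->
    (forall l i : nat, (1 <= l <= 2)%N -> (1 <= i <= m - 1)%N ->
       (gap xi i ^+ l)^-1 *
         (\sum_(0 <= k < l.+1)
            (-1) ^+ (l - k) * 'C(l, k)%:R * coef b (d * i + k - l))
       - (gap xi i.+1 ^+ l)^-1 *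
         (\sum_(0 <= k < l.+1)
            (-1) ^+ (l - k) * 'C(l, k)%:R * coef b (d * i + k)) = 0).

Definition kernel_space (R : realType) (M N : nat) (H : 'M[R]_(M, N))
    : set 'cV[R]_N :=
  [set b | H *m b = 0].

Definition is_orth_projection_mx (R : realType) (N : nat) (S : set 'cV[R]_N)
    (P : 'M[R]_N) : Prop :=
  forall b : 'cV[R]_N,
    S (P *m b) /\ forall z : 'cV[R]_N, S z -> dot (b - P *m b) z = 0.

Definition is_smallest_pos_eigenvalue (R : realType) (N : nat) (M : 'M[R]_N)
    (gamma : R) : Prop :=
  [/\ 0 < gamma, eigenvalue M gamma &
      forall mu : R, 0 < mu -> eigenvalue M mu -> gamma <= mu].

Definition objective (R : realType) (n N : nat) (y : 'cV[R]_n)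
    (A : 'M[R]_(n, N)) (Q : 'M[R]_N) (lambda : R) (b : 'cV[R]_N) : R :=
  sqnorm2 (y - A *m b) + lambda * dot b (Q *m b).

Definition hessian_on_kernel (R : realType) (n N : nat)
    (A : 'M[R]_(n, N)) (Q : 'M[R]_N) (lambda : R) (P : 'M[R]_N) : 'M[R]_N :=
  2 *: (P *m (A^T *m A + lambda *: Q) *m P).

(* T i is the set of parameters at which the nonnegativity constraint on the
   ith piece is imposed. *)
Definition feasible (R : realType) (d m : nat)
    (H : 'M[R]_(2 * m - 2, (d * m).+1)) (T : nat -> set R)
    : set 'cV[R]_(d * m).+1 :=
  [set b | (forall (i : nat) (tau : R), (1 <= i <= m)%N -> T i tau ->
              0 <= dot (gvec d tau) (block b i)) /\
           kernel_space H b].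

Definition gfun (R : realType) (d m : nat) (i : nat) (b : 'cV[R]_(d * m).+1)
    (tau : R) : R :=
  - dot (gvec d tau) (block b i).

(* A maximum, since gfun i b is continuous on the compact interval [0, 1]. *)
Definition phi (R : realType) (d m : nat) (i : nat) (b : 'cV[R]_(d * m).+1)
    : R :=
  sup [set gfun i b tau | tau in `[0, 1]].

Fixpoint cuts (R : realType) (d m : nat) (eps : R)
    (b : nat -> 'cV[R]_(d * m).+1) (tau : nat -> nat -> R) (r : nat) (i : nat)
    : set R :=
  if r is q.+1 then
    if eps < gfun i (b q) (tau i q)
    then cuts eps b tau q i `|` [set tau i q]
    else cuts eps b tau q i
  else set0.

(* The algorithm has not terminated before iteration r. *)
Definition generated (R : realType) (d m : nat) (eps : R)
    (b : nat -> 'cV[R]_(d * m).+1) (tau : nat -> nat -> R) (r : nat) : Prop :=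
  forall q : nat, (q < r)%N ->
    exists2 i : nat, (1 <= i <= m)%N & eps < gfun i (b q) (tau i q).

(* Nothing is required of b r and tau i r once the algorithm has stopped. *)
Definition cutting_plane_run (R : realType) (d m : nat)
    (f : 'cV[R]_(d * m).+1 -> R) (H : 'M[R]_(2 * m - 2, (d * m).+1)) (eps : R)
    (b : nat -> 'cV[R]_(d * m).+1) (tau : nat -> nat -> R) : Prop :=
  forall r : nat, generated eps b tau r ->
    is_minimizer f (feasible H (cuts eps b tau r)) (b r) /\
    forall i : nat, (1 <= i <= m)%N -> 0 <= tau i r <= 1.

(* Main.v *)
Require Import Defs.
From HB Require Import structures.
From mathcomp Require Import all_boot all_order all_algebra.
From mathcomp Require Import all_classical all_reals all_analysis.
From mathcomp Require Import ring lra.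
Set Implicit Arguments.
Unset Strict Implicit.
Unset Printing Implicit Defensive.
Import Order.TTheory GRing.Theory Num.Theory.
Import numFieldNormedType.Exports.
Local Open Scope classical_set_scope.
Local Open Scope ring_scope.

(* On the kernel of H the quadratic form of f is positive definite: if it
   vanishes at b, all pieces are affine, the smoothness conditions glue them to
   one affine function, and this function has the two zeros x_0 < x_n. Hence
   gamma bounds the form from below there, and the growth of f away from its
   minimizer b_r over the relaxed feasible set, which contains bstar, gives the
   first claim.

   For the rate, put D_r = f(bstar) - f(b_r) and let Phi be 1 / (1 - delta) times
   the largest computed violation at b_r, which bounds all phi_i(b_r). As the
   constant spline 1 raises every piece by 1, b_r + Phi 1 is feasible for (P),
   so D_r <= K Phi. The cut added at b_r forces the distance from b_r to b_(r+1)
   to be at least (1 - delta) Phi, so f grows by at least c Phi^2. Together,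
   D_(r+1) <= D_r - kappa D_r^2, which implies D_r <= 1 / (kappa r). *)

(** * Rayleigh quotients *)

Section dot_product.
Variables (R : realType) (N : nat).
Implicit Types (u v w : 'cV[R]_N) (M : 'M[R]_N).

Lemma dotE u v : dot u v = \sum_k u k 0 * v k 0.
Proof. by rewrite /dot mxE; apply: eq_bigr => k _; rewrite mxE. Qed.

Lemma dotC u v : dot u v = dot v u.
Proof. by rewrite !dotE; apply: eq_bigr => k _; rewrite mulrC. Qed.

Lemma dotDr u v w : dot u (v + w) = dot u v + dot u w.
Proof. by rewrite /dot mulmxDr mxE. Qed.

Lemma dotZr a u v : dot u (a *: v) = a * dot u v.
Proof. by rewrite /dot -scalemxAr mxE. Qed.

Lemma dotNr u v : dot u (- v) = - dot u v.
Proof. by rewrite -scaleN1r dotZr mulN1r. Qed.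

Lemma dotBr u v w : dot u (v - w) = dot u v - dot u w.
Proof. by rewrite dotDr dotNr. Qed.

Lemma dotDl u v w : dot (u + v) w = dot u w + dot v w.
Proof. by rewrite !(dotC _ w) dotDr. Qed.

Lemma dotZl a u v : dot (a *: u) v = a * dot u v.
Proof. by rewrite !(dotC _ v) dotZr. Qed.

Lemma dotBl u v w : dot (u - v) w = dot u w - dot v w.
Proof. by rewrite !(dotC _ w) dotBr. Qed.

Lemma dot_mulmxr M u v : dot u (M *m v) = dot (M^T *m u) v.
Proof. by rewrite /dot trmx_mul trmxK mulmxA. Qed.

Lemma dot_sqnorm2 u : dot u u = sqnorm2 u.
Proof. by rewrite dotE; apply: eq_bigr => k _; rewrite expr2. Qed.

Lemma sqnorm2_ge0 u : 0 <= sqnorm2 u.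
Proof. by apply: sumr_ge0 => k _; rewrite sqr_ge0. Qed.

Lemma sqr_coord_le_sqnorm2 u k : u k 0 ^+ 2 <= sqnorm2 u.
Proof.
rewrite /sqnorm2 (bigD1 k)//= lerDl sumr_ge0// => i _; exact: sqr_ge0.
Qed.

Lemma sqnorm2_eq0 u : sqnorm2 u = 0 -> u = 0.
Proof.
move=> u0; apply/matrixP => k j; rewrite ord1 !mxE; apply/eqP.
by rewrite -sqrf_eq0 eq_le sqr_ge0 andbT -u0 sqr_coord_le_sqnorm2.
Qed.

End dot_product.

(** Since [b - P *m b] is orthogonal to the kernel, which contains [P *m a], the form
    [dot (P *m a) b] equals [dot (P *m a) (P *m b)], which is symmetric in [a] and [b]. *)
Lemma orth_projection_sym (R : realType) (M N : nat) (H : 'M[R]_(M, N))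
    (P : 'M[R]_N) : is_orth_projection_mx (kernel_space H) P -> P^T = P.
Proof.
move=> hP.
have aux a b : dot (P *m a) b = dot (P *m a) (P *m b).
  apply/eqP; rewrite -subr_eq0 -dotBr dotC; apply/eqP.
  by have [_] := hP b; apply; have [] := hP a.
have sym a b : dot (P *m a) b = dot a (P *m b).
  by rewrite aux dotC -aux dotC.
have dotd (u : 'cV[R]_N) k : dot u (delta_mx k 0) = u k 0.
  rewrite dotE (bigD1 k)//= big1 ?addr0 ?mxE ?eqxx ?mulr1// => i /negbTE ik.
  by rewrite mxE ik mulr0.
apply/matrixP => i j; rewrite mxE.
have := sym (delta_mx i 0) (delta_mx j 0).
by rewrite dotd [RHS]dotC dotd -!colE !mxE.
Qed.

(** The difference [v - P *m v] lies in the kernel and is orthogonal to it, hence to itself. *)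
Lemma orth_projection_id (R : realType) (M N : nat) (H : 'M[R]_(M, N))
    (P : 'M[R]_N) (v : 'cV[R]_N) :
  is_orth_projection_mx (kernel_space H) P -> H *m v = 0 -> P *m v = v.
Proof.
move=> /(_ v)[HPv orth] Hv; apply/esym/eqP; rewrite -subr_eq0; apply/eqP.
apply: sqnorm2_eq0; rewrite -dot_sqnorm2; apply: orth.
by rewrite /kernel_space /= mulmxBr Hv HPv subr0.
Qed.

Lemma continuous_mul (R : realType) (T : topologicalType) (f g : T -> R) :
  continuous f -> continuous g -> continuous (fun t => f t * g t).
Proof. by move=> cf cg t; exact: (continuousM (cf t) (cg t)). Qed.

Lemma continuous_sum (R : realType) (T : topologicalType) (I : finType)
    (f : I -> T -> R) :
  (forall i, continuous (f i)) -> continuous (fun t => \sum_i f i t).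
Proof.
by move=> cf; apply: continuous_big => [|i _]; [exact: add_continuous|exact: cf].
Qed.

Lemma continuous_dot_mulmx (R : realType) (N : nat) (M : 'M[R]_N) :
  continuous (fun v : 'rV[R]_N => dot v^T (M *m v^T)).
Proof.
have -> : (fun v : 'rV[R]_N => dot v^T (M *m v^T)) =
    (fun v => \sum_k v 0 k * \sum_j M k j * v 0 j).
  apply/funext => v; rewrite dotE; apply: eq_bigr => k _.
  by rewrite !mxE; congr (_ * _); apply: eq_bigr => j _; rewrite mxE.
apply: continuous_sum => k; apply: continuous_mul.
  exact: coord_continuous.
by apply: continuous_sum => j; apply: continuous_mul;
  [exact: cst_continuous|exact: coord_continuous].
Qed.

(** First-order condition at an interior minimum: if [B] were nonzero, the small step
    [- B / (1 + |C|)] would make the quadratic negative. *)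
Lemma quadratic_ge0_linear_eq0 (R : realType) (B C : R) :
  (forall t, 0 <= 2 * t * B + t ^+ 2 * C) -> B = 0.
Proof.
move=> h; apply/eqP/negPn/negP => B0.
have B2 : 0 < B ^+ 2 by rewrite exprn_even_gt0.
have c1 : 0 < 1 + `|C| by rewrite ltr_pwDl.
have := h (- B / (1 + `|C|)).
have -> : 2 * (- B / (1 + `|C|)) * B + (- B / (1 + `|C|)) ^+ 2 * C =
    B ^+ 2 / (1 + `|C|) ^+ 2 * (C - 2 * (1 + `|C|)).
  by field; rewrite gt_eqF.
rewrite pmulr_rge0; last by rewrite divr_gt0// exprn_gt0.
by have := ler_norm C; have := normr_ge0 C; lra.
Qed.

(* The minimum of the Rayleigh quotient over the unit sphere of the kernel is
   attained, at an eigenvector. *)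
Lemma smallest_eigenvalue_le (R : realType) (N L : nat) (H : 'M[R]_(L, N))
    (M : 'M[R]_N) (gamma : R) (v : 'cV[R]_N) :
  M^T = M -> H *m M = 0 ->
  (forall w, H *m w = 0 -> w != 0 -> 0 < dot w (M *m w)) ->
  is_smallest_pos_eigenvalue M gamma ->
  H *m v = 0 -> gamma * sqnorm2 v <= dot v (M *m v).
Proof.
move=> symM HM posM [_ _ hgamma] Hv.
have [->|v0] := eqVneq v 0.
  by rewrite -dot_sqnorm2 dotE /dot mulmx0 mulmx0 mxE big1 ?mulr0// => k _;
     rewrite mxE mul0r.
have norm_gt0 (w : 'cV[R]_N) : w != 0 -> 0 < sqnorm2 w.
  move=> w0; rewrite lt_neqAle sqnorm2_ge0 andbT eq_sym.
  by apply: contra_neq w0; exact: sqnorm2_eq0.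
pose q (w : 'rV[R]_N) := dot w^T (M *m w^T).
pose K := [set w : 'rV[R]_N | H *m w^T = 0 /\ sqnorm2 w^T = 1].
pose unitv (w : 'cV[R]_N) := (Num.sqrt (sqnorm2 w))^-1 *: w.
have unitK (w : 'cV[R]_N) : H *m w = 0 -> w != 0 -> K (unitv w)^T.
  move=> Hw w0; split; rewrite trmxK; first by rewrite -scalemxAr Hw scaler0.
  rewrite -dot_sqnorm2 dotZl dotZr dot_sqnorm2 mulrA -expr2 exprVn.
  by rewrite sqr_sqrtr ?sqnorm2_ge0// mulVf// gt_eqF// norm_gt0.
(* Coordinates of unit vectors are at most 1 in absolute value; closedness comes from writing [K] as
   common zeros of linear forms cut by a level set of a quadratic form. *)
have cK : compact K.
  apply: bounded_closed_compact.
    exists 1; split=> // e e1 w [_ w1]; apply: le_trans (ltW e1).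
    rewrite [leLHS]/Num.Def.normr /= mx_normrE.
    apply/bigmax_leP; split => //= -[i k] _ /=.
    rewrite ord1 -(ler_pXn2r (ltn0Sn 1)) ?nnegrE// expr1n -normrX.
    rewrite ger0_norm ?sqr_ge0//.
    by have := sqr_coord_le_sqnorm2 w^T k; rewrite mxE w1.
  have -> : K = [set w : 'rV[R]_N | forall i, \sum_k H i k * w 0 k = 0] `&`
                [set w | dot w^T (1%:M *m w^T) = 1].
    apply/seteqP; split=> w /=.
      move=> [Hw w1]; split; last by rewrite mul1mx dot_sqnorm2.
      move=> i; have /matrixP/(_ i 0) := Hw; rewrite !mxE => Hwi.
      rewrite -[RHS]Hwi.
      by apply: eq_bigr => k _; rewrite mxE.
    rewrite mul1mx dot_sqnorm2 => -[Hw w1]; split => //.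
    apply/matrixP => i j; rewrite ord1 !mxE -[RHS](Hw i).
    by apply: eq_bigr => k _; rewrite mxE.
  apply: closedI.
    have -> : [set w : 'rV[R]_N | forall i, \sum_k H i k * w 0 k = 0] =
        \bigcap_(i in [set: 'I_L]) [set w : 'rV[R]_N | \sum_k H i k * w 0 k = 0].
      by apply/seteqP; split=> w /= h i; [move=> _|]; exact: h.
    apply: closed_bigI => i _.
    apply: (@preimage_closed _ _ (fun w : 'rV[R]_N => \sum_k H i k * w 0 k)
      [set 0]); last exact: closed_eq.
    move=> w _; move: w; apply: continuous_sum => j.
    by apply: continuous_mul; [exact: cst_continuous|exact: coord_continuous].
  apply: (@preimage_closed _ _ (fun w : 'rV[R]_N => dot w^T (1%:M *m w^T))
    [set 1]); last exact: closed_eq.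
  by move=> w _; exact: continuous_dot_mulmx.
have [||w0] := @EVT_min_rV _ _ q K _ cK.
- by exists (unitv v)^T; exact: unitK.
- by apply: continuous_subspaceT; exact: continuous_dot_mulmx.
rewrite inE => -[Hw0 w01] qmin.
pose u := w0^T; pose mu := dot u (M *m u).
have qge w : H *m w = 0 -> mu * sqnorm2 w <= dot w (M *m w).
  move=> Hw; have [->|wn0] := eqVneq w 0.
    by rewrite -dot_sqnorm2 {1}dotE /dot mulmx0 mulmx0 mxE big1 ?mulr0// => k _;
       rewrite mxE mul0r.
  have := qmin (unitv w)^T; rewrite inE => /(_ (unitK _ Hw wn0)).
  rewrite /q -/u -/mu trmxK dotZl -scalemxAr dotZr mulrA -expr2 exprVn.
  by rewrite sqr_sqrtr ?sqnorm2_ge0// mulrC ler_pdivlMr// norm_gt0.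
have u0 : u != 0.
  apply/eqP => u0; move: w01; rewrite -/u u0 => /eqP.
  by rewrite -dot_sqnorm2 /dot mulmx0 mxE eq_sym oner_eq0.
have mu_gt0 : 0 < mu by exact: posM.
(* First variation: [qge] at [u + t *: w] is a nonnegative quadratic in [t] without constant term,
   so its linear coefficient vanishes. *)
have orth w : H *m w = 0 -> dot w (M *m u - mu *: u) = 0.
  move=> Hw; apply: (@quadratic_ge0_linear_eq0 _ _
    (dot w (M *m w) - mu * sqnorm2 w)) => t.
  have := qge (u + t *: w); rewrite mulmxDr Hw0 -scalemxAr Hw scaler0 addr0.
  move=> /(_ erefl); rewrite -subr_ge0.
  rewrite -!dot_sqnorm2 mulmxDr -scalemxAr dotBr !(dotDl,dotDr) !(dotZl, dotZr).
  rewrite -/mu (dot_sqnorm2 u) w01.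
  rewrite (dot_mulmxr M u w) symM (dotC (M *m u)) (dotC u w).
  by move=> h; apply: le_trans h _; rewrite le_eqVlt; apply/orP; left;
    apply/eqP; ring.
(* Because [H *m M = 0], the residual [M *m u - mu *: u] is itself in the kernel and may be tested
   against itself. *)
have Mu : M *m u = mu *: u.
  apply/eqP; rewrite -subr_eq0; apply/eqP/sqnorm2_eq0.
  rewrite -dot_sqnorm2 orth// mulmxBr mulmxA HM mul0mx -scalemxAr Hw0.
  by rewrite scaler0 subr0.
apply: le_trans (qge v Hv); rewrite ler_wpM2r ?sqnorm2_ge0//.
apply: hgamma => //; apply/eigenvalueP; exists u^T; last by rewrite -trmx_eq0 trmxK.
by rewrite -{1}symM -trmx_mul Mu linearZ.
Qed.

(** * Splines in Bernstein form *)

(** A formal polynomial rather than a function, so that root counting and formal derivatives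
    apply. *)
Definition bernstein (R : nzRingType) (d : nat) (c : nat -> R) : {poly R} :=
  \sum_(k < d.+1) ('C(d, k)%:R * c k) *: ((1 - 'X) ^+ (d - k) * 'X^k).

Section bernstein_theory.
Variables (R : realType) (d : nat).
Implicit Types (c : nat -> R).

Lemma horner_bernstein c (t : R) : (bernstein d c).[t] =
  \sum_(k < d.+1) 'C(d, k)%:R * (1 - t) ^+ (d - k) * t ^+ k * c k.
Proof.
rewrite /bernstein horner_sum; apply: eq_bigr => k _.
rewrite !hornerE /=; ring.
Qed.

(* The substitution [t = u / (1 + u)] turns the Bernstein form into the monomial
   form, up to the factor [(1 + u) ^+ d]. *)
Lemma bernstein_eq0 c : (forall t : R, (bernstein d c).[t] = 0) ->
  forall k, (k <= d)%N -> c k = 0.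
Proof.
move=> c0; pose p := \poly_(k < d.+1) ('C(d, k)%:R * c k).
(* The points [t = j / (1 + j)] correspond to [u = j], which gives [p] more roots than its degree
   allows. *)
have root_nat (j : nat) : p.[j%:R] = 0.
  have j1 : (1 + j%:R : R) != 0 by rewrite gt_eqF// ltr_pwDl.
  have -> : p.[j%:R] = (1 + j%:R) ^+ d * (bernstein d c).[j%:R / (1 + j%:R)].
    rewrite horner_bernstein horner_poly mulr_sumr; apply: eq_bigr => k _.
    have -> : 1 - j%:R / (1 + j%:R) = (1 + j%:R : R)^-1 by field.
    have kd : (k <= d)%N by rewrite -ltnS.
    rewrite -[in (1 + j%:R) ^+ d](subnK kd) exprD exprVn expr_div_n.
    by field; rewrite !expf_neq0.
  by rewrite c0 mulr0.
have p0 : p = 0.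
  apply: (@roots_geq_poly_eq0 _ _ [seq j%:R | j <- iota 0 d.+1]).
  - by apply/allP => _ /mapP[j _ ->]; apply/eqP.
  - rewrite map_inj_uniq ?iota_uniq// => i j /eqP; rewrite eqr_nat => /eqP //.
  - by rewrite size_map size_iota size_poly.
move=> k kd; have /eqP := congr1 (fun q : {poly R} => q`_k) p0.
rewrite coef_poly ltnS kd coef0 mulf_eq0 pnatr_eq0 => /orP[|/eqP//].
by rewrite -leqn0 leqNgt bin_gt0 kd.
Qed.

Lemma bernsteinB c c' : bernstein d (fun k => c k - c' k) =
  bernstein d c - bernstein d c'.
Proof.
by rewrite /bernstein -sumrB; apply: eq_bigr => k _; rewrite mulrBr scalerBl.
Qed.

(** The binomial theorem makes the basis sum to 1; the absorption identity for [k * 'C(d, k)]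
    reduces the first moment to the same sum in degree [d - 1]. *)
Lemma bernstein_affine (u v t : R) :
  (bernstein d (fun k => u + v * k%:R)).[t] = u + v * d%:R * t.
Proof.
rewrite horner_bernstein.
have binomial_sum e :
    \sum_(k < e.+1) 'C(e, k)%:R * (1 - t) ^+ (e - k) * t ^+ k = 1.
  transitivity (((1 - t) + t) ^+ e); last by rewrite subrK expr1n.
  by rewrite exprDn; apply: eq_bigr => k _; rewrite -mulrA mulr_natl.
under eq_bigr do rewrite mulrDr.
rewrite big_split /= -mulr_suml binomial_sum mul1r; congr (_ + _).
case: d => [|e]; first by rewrite big_ord1 /= !mulr0 mul0r.
rewrite big_ord_recl /= !mulr0 add0r.
rewrite -[RHS]mulr1 -[X in _ = _ * X](binomial_sum e) mulr_sumr.
apply: eq_bigr => k _; rewrite /bump /= add1n subSS exprS.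
have : (k.+1)%:R * 'C(e.+1, k.+1)%:R = (e.+1)%:R * 'C(e, k)%:R :> R.
  by rewrite -!natrM -mul_bin_diag.
move=> h; transitivity (v * t * (1 - t) ^+ (e - k) * t ^+ k *
  (k.+1%:R * 'C(e.+1, k.+1)%:R)); first by ring.
by rewrite h; ring.
Qed.

End bernstein_theory.

(** * Polynomials with vanishing second derivative or square integral *)

Lemma derive1n_horner (R : realType) (p : {poly R}) (k : nat) :
  derive1n k (horner p) = horner p^`(k).
Proof.
elim: k => [|k IH]; first by rewrite derive1n0 derivn0.
by rewrite derive1nS IH derivnS derivE.
Qed.

Lemma poly_deriv2_eq0 (R : realType) (p : {poly R}) : p^`(2) = 0 ->
  forall t, p.[t] = p`_0 + p`_1 * t.
Proof.
move=> p2 t; suff sp : (size p <= 2)%N.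
  rewrite (horner_coef_wide _ sp) !big_ord_recl big_ord0 /=.
  by rewrite expr0 mulr1 addr0 expr1.
apply/leq_sizeP => j; case: j => [//|[//|j]] _.
have /eqP := congr1 (fun q : {poly R} => q`_j) p2.
rewrite coef_derivn coef0 add2n -mulr_natr mulf_eq0 pnatr_eq0.
by move=> /orP[/eqP//|]; rewrite -leqn0 leqNgt ffact_gt0.
Qed.

Lemma finite_roots (R : idomainType) (p : {poly R}) : p != 0 ->
  finite_set [set t | root p t].
Proof.
move=> p0; apply: contrapT => /(infinite_set_fset (size p)) [B Bp].
rewrite leqNgt => /negP; apply; apply: max_poly_roots (finmap.fset_uniq _) => //.
by apply/allP => t tB; exact: Bp.
Qed.

(** A nonnegative function with zero integral vanishes almost everywhere. For [p != 0] the interval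
    would be covered by a null set and the finitely many roots of [p], against its positive
    length. *)
Lemma Rintegral_sqr_poly_eq0 (R : realType) (p : {poly R}) (a b : R) : a < b ->
  \int[@lebesgue_measure R]_(t in `[a, b]) (`| p.[t] | ^+ 2) = 0 -> p = 0.
Proof.
move=> ab; have -> : (fun t => `|p.[t]| ^+ 2) = horner (p ^+ 2).
  by apply/funext => t; rewrite horner_exp -normrX ger0_norm// sqr_ge0.
set q := p ^+ 2; have q_ge0 t : 0 <= q.[t] by rewrite horner_exp sqr_ge0.
move=> int0; apply/eqP/negPn/negP => p0.
have cq : {within `[a, b], continuous (horner q)}.
  by apply: continuous_subspaceT; exact: continuous_horner.
have iq : (@lebesgue_measure R).-integrable `[a, b] (EFin \o horner q).
  exact: continuous_compact_integrable (@segment_compact _ _ _) cq.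
have : (\int[@lebesgue_measure R]_(t in `[a, b]) `|(EFin \o horner q) t| = 0)%E.
  rewrite -[RHS]/(0%:E) -int0 /Rintegral fineK; last first.
    by rewrite integrable_fin_num.
  by apply: eq_integral => t _ /=; rewrite ger0_norm.
move=> abs0.
have [] := proj1 (ae_eq_integral_abs (@lebesgue_measure R) (measurable_itv _)
  (measurable_int _ iq)) abs0.
move=> Z [mZ Z0 sZ].
have : (@lebesgue_measure R `[a, b] <= 0)%E.
  have cr : countable [set t | root p t] by apply/finite_set_countable/finite_roots.
  have sub : `[a, b] `<=` Z `|` [set t | root p t].
    move=> t tab; have [rt|nrt] := boolP (root p t); [by right|left].
    apply: sZ => /= /(_ tab) [] /eqP; rewrite horner_exp sqrf_eq0 => /eqP/rootP.
    by rewrite (negbTE nrt).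
  have mr : measurable [set t | root p t].
    by apply: countable_measurable.
  rewrite (_ : lebesgue_measure `[a, b] = 0)%E//; apply/negligibleP => //.
  apply: (@negligibleS _ _ _ (@lebesgue_measure R) _ _ sub).
  apply: negligibleU; apply/negligibleP => //.
  exact: countable_lebesgue_measure0.
rewrite lebesgue_measure_itv /= lte_fin ab -EFinB lee_fin subr_le0.
by rewrite leNgt ab.
Qed.

Lemma dot_gvec_block (R : realType) (d m : nat) (b : 'cV[R]_(d * m).+1) (i : nat)
    (t : R) : dot (gvec d t) (block b i) =
  (bernstein d (fun k => coef b (d * i.-1 + k))).[t].
Proof.
by rewrite dotE horner_bernstein; apply: eq_bigr => k _; rewrite !mxE.
Qed.

(** * Affine pieces and definiteness on the kernel of [H] *)

Section spline_pieces.
Variables (R : realType) (m d : nat) (xi : nat -> R).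
Hypothesis xi_lt : forall i : nat, (i < m)%N -> xi i < xi i.+1.
Implicit Types (b : 'cV[R]_(d * m).+1).

Lemma gap_gt0 i : (1 <= i <= m)%N -> 0 < gap xi i.
Proof. by case: i => // i /= im; rewrite /gap subr_gt0 xi_lt. Qed.

Lemma exists_piece (t : R) : (1 <= m)%N -> xi 0%N <= t <= xi m ->
  exists2 i, (1 <= i <= m)%N & xi i.-1 <= t <= xi i.
Proof.
elim: m => // n IH _ /andP[t0 tn].
have [tle|tgt] := leP t (xi n); last by exists n.+1; rewrite ?ltnS ?leqnn ?(ltW tgt).
case: n IH tle tn => [|n] IH tle tn.
  by exists 1%N; rewrite // t0 tn.
have [//||i /andP[i1 iN] ti] := IH; first by rewrite t0 tle.
by exists i; rewrite // i1 leqW.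
Qed.

Lemma piece_horner b i : piece xi b i =
  horner (bernstein d (fun k => coef b (d * i.-1 + k)) \Po
          ((gap xi i)^-1 *: ('X - (xi i.-1)%:P))).
Proof.
apply/funext => t; rewrite /piece dot_gvec_block horner_comp !hornerE.
by rewrite mulrC.
Qed.

Lemma piece_affine b i (u v : R) : (1 <= i <= m)%N ->
  (forall k, (k <= d)%N -> coef b (d * i.-1 + k) = u + v * k%:R) ->
  forall t, piece xi b i t = u + v * d%:R * ((t - xi i.-1) / gap xi i).
Proof.
move=> im cb t; rewrite /piece dot_gvec_block -bernstein_affine.
rewrite !horner_bernstein; apply: eq_bigr => k _; congr (_ * _).
by apply: cb; rewrite -ltnS.
Qed.

Lemma flat_piece_coef b i : (1 <= i <= m)%N -> (0 < d)%N ->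
  \int[@lebesgue_measure R]_(t in `[xi i.-1, xi i])
    (`| derive1n 2 (piece xi b i) t | ^+ 2) = 0 ->
  exists u v : R, forall k, (k <= d)%N -> coef b (d * i.-1 + k) = u + v * k%:R.
Proof.
move=> im d0; have g0 := gap_gt0 im.
rewrite piece_horner derive1n_horner => /Rintegral_sqr_poly_eq0.
have -> : xi i.-1 < xi i by rewrite -subr_gt0.
move=> /(_ isT) /poly_deriv2_eq0; set p := (_ \Po _) => pE.
have dn0 : d%:R != 0 :> R by rewrite pnatr_eq0 -lt0n.
(* The value at the left knot, and a [d]-th part of the total increase over the piece; uniqueness of
   Bernstein coefficients does the rest. *)
exists (p`_0 + p`_1 * xi i.-1), (p`_1 * gap xi i / d%:R) => k kd.
apply/eqP; rewrite -subr_eq0; apply/eqP; move: k kd.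
apply: bernstein_eq0 => t; rewrite bernsteinB !hornerE bernstein_affine divfK//.
have := pE (xi i.-1 + gap xi i * t); rewrite /p horner_comp !hornerE.
have -> : (gap xi i)^-1 * (xi i.-1 + gap xi i * t - xi i.-1) = t.
  by field; rewrite gt_eqF.
by move=> ->; ring.
Qed.

(** All coefficients are 1, so each condition reduces to alternating binomial sums, which vanish for
    [l = 1, 2]. *)
Lemma smoothness_mx_const (H : 'M[R]_(2 * m - 2, (d * m).+1)) :
  is_smoothness_mx xi H -> H *m (const_mx 1 : 'cV[R]_(d * m).+1) = 0.
Proof.
move=> hH; apply/hH => l i l2 im.
have z (f : nat -> nat) : \sum_(0 <= k < l.+1)
    (-1) ^+ (l - k) * 'C(l, k)%:R * coef (const_mx 1 : 'cV[R]_(d * m).+1) (f k)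
    = 0.
  under eq_bigr do rewrite /coef mxE mulr1.
  by case: l l2 => [|[|[|]]] // _; rewrite !big_nat_recr //= big_geq //=
    ?bin0 ?bin1 ?binn ?subnn /=; ring.
by rewrite (z (fun k => d * i + k - l)%N) (z (fun k => d * i + k)%N) !mulr0 subr0.
Qed.

(** The condition with [l = 1]: up to the factor [d], both sides are one-sided derivatives at the
    knot [xi i]. *)
Lemma kernel_slope (H : 'M[R]_(2 * m - 2, (d * m).+1)) b (i : nat) :
  is_smoothness_mx xi H -> H *m b = 0 -> (1 <= i <= m - 1)%N ->
  (coef b (d * i) - coef b (d * i).-1) / gap xi i =
  (coef b (d * i).+1 - coef b (d * i)) / gap xi i.+1.
Proof.
move=> hH /hH /(_ 1%N i isT) h im; move: (h im).
rewrite !expr1 !big_nat_recr //= !big_geq //= !bin0 !binn !subnn !subn0.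
rewrite !addn0 !addn1 subn1 subn1 /= expr0 expr1 => /eqP.
by rewrite add0r add0r subr_eq0 => /eqP e; lra.
Qed.

(** The coefficients are the values of the affine function [u + s * d * (t - xi 0)] at the
    equidistant points [xi i.-1 + k * gap xi i / d]. By induction on [i], the value and slope at a
    knot carry this function to the next piece. *)
Lemma flat_kernel_affine (H : 'M[R]_(2 * m - 2, (d * m).+1)) b :
  (1 <= m)%N -> (0 < d)%N -> is_smoothness_mx xi H -> H *m b = 0 ->
  (forall i, (1 <= i <= m)%N ->
    \int[@lebesgue_measure R]_(t in `[xi i.-1, xi i])
      (`| derive1n 2 (piece xi b i) t | ^+ 2) = 0) ->
  exists u s : R, forall i, (1 <= i <= m)%N -> forall k, (k <= d)%N ->
    coef b (d * i.-1 + k) =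
      u + s * (d%:R * (xi i.-1 - xi 0%N) + k%:R * gap xi i).
Proof.
move=> m1 d0 hH Hb flat.
have [u [v uv]] := flat_piece_coef (b := b) (i := 1) (ltac:(by rewrite m1))
  d0 (flat 1%N (ltac:(by rewrite m1))).
have g1 : 0 < gap xi 1 by rewrite gap_gt0// m1.
exists u, (v / gap xi 1); elim=> // i IH im k kd.
case: i IH im => [|i] IH im.
  by rewrite uv// subrr; field; rewrite gt_eqF.
have im' : (1 <= i.+1 <= m)%N by move: im => /= /ltnW.
have {}IH := IH im'.
have [u' [v' uv']] := flat_piece_coef im d0 (flat _ im).
have gi := gap_gt0 im'; have gi1 := gap_gt0 im.
(* Continuity: the last coefficient of one block is the first of the next. *)
have uE : u' = u + v / gap xi 1 * (d%:R * (xi i.+1 - xi 0%N)).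
  have := uv' 0%N isT; rewrite addn0 mulr0 addr0 => <-.
  have := IH d (leqnn d); rewrite /= -mulnSr => ->.
  by rewrite /gap /=; ring.
have vE : v' = v / gap xi 1 * gap xi i.+2.
  have := kernel_slope hH Hb (i := i.+1); rewrite subn1.
  have -> : (1 <= i.+1 <= m.-1)%N.
    by move: im; case: (m).
  move=> /(_ isT).
  have := uv' 0%N isT; have := uv' 1%N d0; rewrite /= addn0 addn1 mulr0 mulr1 addr0.
  move=> -> ->.
  have := IH d.-1 (leq_pred d); rewrite /=.
  have -> : (d * i + d.-1 = (d * i.+1).-1)%N.
    by rewrite mulnSr; case: (d) d0 => // e _; rewrite addnS.
  move=> ->; rewrite -[in d%:R](prednK d0) -natr1.
  set e := d.-1%:R; rewrite uE -[in d%:R](prednK d0) -natr1 -/e.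
  have -> : u + v / gap xi 1 * ((e + 1) * (xi i.+1 - xi 0%N)) -
     (u + v / gap xi 1 * ((e + 1) * (xi i - xi 0%N) + e * gap xi i.+1)) =
     v / gap xi 1 * gap xi i.+1 by rewrite /gap /=; ring.
  rewrite mulfK ?gt_eqF// => ->.
  by field; rewrite !gt_eqF.
by rewrite uv'// uE vE /=; ring.
Qed.

End spline_pieces.

(** An index [k < d * m] has offset [k %% d] in block [k %/ d + 1]; the remaining index [d * m] ends
    block [m]. *)
Lemma blocks_eq0 (R : realType) (d m : nat) (b : 'cV[R]_(d * m).+1) :
  (1 <= m)%N -> (0 < d)%N ->
  (forall i, (1 <= i <= m)%N -> forall k, (k <= d)%N ->
    coef b (d * i.-1 + k) = 0) -> b = 0.
Proof.
move=> m1 d0 b0; apply/matrixP => k j; rewrite ord1 mxE -[k]inord_val.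
rewrite -/(coef b k); have [km|km] := ltnP k (d * m).
  rewrite [X in coef b X](divn_eq k d) mulnC.
  apply: (b0 (k %/ d).+1); last by rewrite ltnW// ltn_pmod.
  by rewrite /= ltn_divLR// [(m * d)%N]mulnC.
have -> : k = (d * m)%N :> nat by apply/eqP; rewrite eqn_leq km -ltnS ltn_ord.
by have := b0 m; rewrite m1 leqnn => /(_ isT d (leqnn d));
  rewrite -mulnSr prednK.
Qed.

Lemma spline_definite (R : realType) (m d n : nat) (xi : nat -> R)
    (x : 'I_n.+1 -> R) (A : 'M[R]_(n.+1, (d * m).+1)) (Q : 'M[R]_((d * m).+1))
    (H : 'M[R]_(2 * m - 2, (d * m).+1)) (b : 'cV[R]_(d * m).+1) :
  (1 <= m)%N -> (0 < d)%N -> (1 <= n)%N ->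
  (forall i : nat, (i < m)%N -> xi i < xi i.+1) ->
  (forall j k : 'I_n.+1, (j < k)%N -> x j < x k) ->
  xi 0%N <= x ord0 -> x ord_max <= xi m ->
  is_evaluation_mx xi x A -> is_roughness_mx xi Q -> is_smoothness_mx xi H ->
  H *m b = 0 -> A *m b = 0 -> dot b (Q *m b) = 0 -> b = 0.
Proof.
move=> m1 d0 n1 xi_lt x_lt x0 xn hA [_ _ hQ] hH Hb Ab Qb.
have flat i : (1 <= i <= m)%N ->
    \int[@lebesgue_measure R]_(t in `[xi i.-1, xi i])
      (`| derive1n 2 (piece xi b i) t | ^+ 2) = 0.
  move=> im; move: Qb; rewrite hQ => /eqP; rewrite psumr_eq0; last first.
    by move=> k _; apply: Rintegral_ge0 => t _; rewrite exprn_ge0.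
  by move=> /allP /(_ i); rewrite mem_index_iota ltnS => /(_ im) /eqP.
have [u [s us]] := flat_kernel_affine xi_lt m1 d0 hH Hb flat.
(* [A *m b = 0] says that the global affine function vanishes at every data point; two distinct
   points then force [s = 0] and [u = 0]. *)
have zero j : u + s * d%:R * (x j - xi 0%N) = 0.
  have xj : xi 0%N <= x j <= xi m.
    apply/andP; split.
      have [->//|j0] := eqVneq j ord0; apply: (le_trans x0); apply/ltW/x_lt.
      by rewrite lt0n.
    have [->//|jn] := eqVneq j ord_max; apply: le_trans xn; apply/ltW/x_lt.
    by rewrite ltn_neqAle -ltnS ltn_ord andbT.
  have [i im xij] := exists_piece m1 xj.
  have /matrixP/(_ j 0) := Ab; rewrite (hA _ _ i)// mxE.
  rewrite (@piece_affine _ _ _ _ _ _ (u + s * d%:R * (xi i.-1 - xi 0%N))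
    (s * gap xi i))//; last by move=> k kd; rewrite us//; ring.
  by move=> <-; field; rewrite gt_eqF// (gap_gt0 xi_lt).
have s0 : s = 0.
  have x01 : x ord0 < x ord_max by apply: x_lt.
  have : s * (d%:R * (x ord_max - x ord0)) = 0.
    by rewrite -[RHS](subrr 0) -{1}(zero ord_max) -(zero ord0); ring.
  move=> /eqP; rewrite !mulf_eq0 pnatr_eq0 subr_eq0 (gt_eqF x01).
  by rewrite (gtn_eqF d0) !orbF => /eqP.
have u0 : u = 0 by have := zero ord0; rewrite s0 !mul0r addr0.
by apply: blocks_eq0 => // i im k kd; rewrite us// u0 s0; ring.
Qed.

(** * The objective and the cuts *)

Section quadratic_objective.
Variables (R : realType) (n N : nat) (y : 'cV[R]_n) (A : 'M[R]_(n, N)).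
Variables (Q : 'M[R]_N) (lambda : R).
Implicit Types (b v : 'cV[R]_N).

Definition objective_quad v : R := sqnorm2 (A *m v) + lambda * dot v (Q *m v).

(* The derivative of the objective at [b] in the direction [v]. *)
Definition objective_slope b v : R :=
  2 * (dot (A *m v) (A *m b) + lambda * dot (Q *m v) b - dot y (A *m v)).

Lemma objective_line b v (t : R) : Q^T = Q ->
  objective y A Q lambda (b + t *: v) =
  objective y A Q lambda b + t * objective_slope b v + t ^+ 2 * objective_quad v.
Proof.
move=> Qsym; rewrite /objective /objective_quad /objective_slope -!dot_sqnorm2.
rewrite !mulmxDr -!scalemxAr !(dotBl, dotBr) !(dotDl, dotDr, dotZl, dotZr).
rewrite (dot_mulmxr Q b v) Qsym (dotC (Q *m b)) (dot_mulmxr Q v b) Qsym.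
rewrite (dotC (A *m b) y) (dotC (A *m v) y) (dotC (A *m b) (A *m v)).
by ring.
Qed.

Lemma objective_ge0 b : 0 <= lambda -> 0 <= dot b (Q *m b) ->
  0 <= objective y A Q lambda b.
Proof. by move=> l0 q0; rewrite addr_ge0 ?sqnorm2_ge0 ?mulr_ge0. Qed.

(** [P] is symmetric and fixes [v], so both projections drop out. *)
Lemma quad_hessian (L : nat) (H : 'M[R]_(L, N)) (P : 'M[R]_N) v :
  is_orth_projection_mx (kernel_space H) P -> H *m v = 0 ->
  dot v (hessian_on_kernel A Q lambda P *m v) = 2 * objective_quad v.
Proof.
move=> hP Hv; have Pv := orth_projection_id hP Hv.
rewrite /hessian_on_kernel -scalemxAl dotZr -!mulmxA Pv dot_mulmxr.
rewrite (orth_projection_sym hP) Pv mulmxDl dotDr -scalemxAl dotZr.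
rewrite -mulmxA /objective_quad; congr (2 * (_ + _)).
by rewrite -dot_sqnorm2 /dot !trmx_mul !mulmxA.
Qed.

Lemma smallest_eigenvalue_le_quad (L : nat) (H : 'M[R]_(L, N)) (P : 'M[R]_N)
    (gamma : R) v :
  Q^T = Q -> is_orth_projection_mx (kernel_space H) P ->
  (forall w, H *m w = 0 -> w != 0 -> 0 < objective_quad w) ->
  is_smallest_pos_eigenvalue (hessian_on_kernel A Q lambda P) gamma ->
  H *m v = 0 -> gamma / 2 * sqnorm2 v <= objective_quad v.
Proof.
move=> Qsym hP pos hgamma Hv.
have Psym := orth_projection_sym hP.
rewrite -(ler_pM2l (ltr0n R 2)) -(quad_hessian hP Hv).
rewrite mulrA [2 * _]mulrC divfK//.
apply: (smallest_eigenvalue_le (H := H)) => //.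
- rewrite /hessian_on_kernel linearZ /= !trmx_mul Psym linearD linearZ /= Qsym.
  by rewrite trmx_mul trmxK mulmxA.
(* Each column of [P] is the projection of a basis vector, hence in the kernel. *)
- have HP : H *m P = 0.
    apply/matrixP => i j; have [+ _] := hP (delta_mx j 0).
    rewrite /kernel_space /= mulmxA -colE => /matrixP/(_ i 0).
    by rewrite !mxE.
  by rewrite /hessian_on_kernel -scalemxAr !mulmxA HP !mul0mx scaler0.
- by move=> w Hw w0; rewrite (quad_hessian hP Hw) mulr_gt0// pos.
Qed.

End quadratic_objective.

Lemma linear_coef_ge0 (R : realType) (l q : R) :
  (forall t, 0 < t <= 1 -> 0 <= t * l + t ^+ 2 * q) -> 0 <= l.
Proof.
move=> h; rewrite leNgt; apply/negP => l0.
have e0 : 0 < - l + 1 + `|q| by have := normr_ge0 q; lra.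
(* This step is at most 1 and satisfies [t * |q| < - l], so the negative linear term dominates. *)
pose t := - l / (- l + 1 + `|q|).
have t0 : 0 < t by rewrite divr_gt0// oppr_gt0.
have t1 : t <= 1 by rewrite ler_pdivrMr// mul1r; have := normr_ge0 q; lra.
have := h t; rewrite t0 t1 => /(_ isT).
have -> : t * l + t ^+ 2 * q = t * (l + t * q) by ring.
rewrite pmulr_rge0//; apply/negP; rewrite -ltNge.
have -> : l + t * q = - l / (- l + 1 + `|q|) * (l - 1 + q - `|q|).
  by rewrite /t; field; rewrite gt_eqF.
by rewrite pmulr_rlt0//; have := ler_norm q; lra.
Qed.

(** The slope of the objective at [b] towards [z] is nonnegative, and the second-order expansion of
    a quadratic is exact at [t = 1]. *)
Lemma minimizer_growth (R : realType) (n N : nat) (y : 'cV[R]_n)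
    (A : 'M[R]_(n, N)) (Q : 'M[R]_N) (lambda : R) (S : set 'cV[R]_N)
    (b z : 'cV[R]_N) :
  Q^T = Q -> is_minimizer (objective y A Q lambda) S b ->
  (forall t, 0 < t <= 1 -> S (b + t *: (z - b))) ->
  objective y A Q lambda b + objective_quad A Q lambda (z - b) <=
  objective y A Q lambda z.
Proof.
move=> Qsym [_ bmin] Sline.
have l0 : 0 <= objective_slope y A Q lambda b (z - b).
  apply: (@linear_coef_ge0 _ _ (objective_quad A Q lambda (z - b))) => t t01.
  by have := bmin _ (Sline t t01); rewrite objective_line//; lra.
rewrite -[in leRHS](subrK b z) [z - b + b]addrC -[in leRHS](scale1r (z - b)).
by rewrite objective_line//; lra.
Qed.

(** A crude form of the Cauchy-Schwarz inequality through [|w_k| <= 1 + w_k ^+ 2], phrased with the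
    squared norm that the error bound controls. *)
Lemma norm_dot_le (R : realType) (N : nat) (u w : 'cV[R]_N) :
  `|dot u w| <= (\sum_k `|u k 0|) * (1 + sqnorm2 w).
Proof.
rewrite dotE mulr_suml; apply: le_trans (ler_norm_sum _ _ _) _.
apply: ler_sum => k _; rewrite normrM ler_wpM2l//.
have := sqr_coord_le_sqnorm2 w k; rewrite -real_normK ?num_real//.
by have := sqr_ge0 (`|w k 0| - 1); nra.
Qed.

(** * The constraint functions of the pieces *)

Section constraints.
Variables (R : realType) (m d : nat).
Implicit Types (b v : 'cV[R]_(d * m).+1) (t tau : R).

Lemma gfun_le0 i b tau :
  (gfun i b tau <= 0) = (0 <= dot (gvec d tau) (block b i)).
Proof. exact: oppr_le0. Qed.

Lemma gfun_line i b v t tau :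
  gfun i (b + t *: v) tau = gfun i b tau + t * gfun i v tau.
Proof.
rewrite /gfun !dotE mulrN -opprD mulr_sumr -big_split /=; congr (- _).
by apply: eq_bigr => k _; rewrite !mxE /coef !mxE; ring.
Qed.

Lemma gfunB i b v tau : gfun i (b - v) tau = gfun i b tau - gfun i v tau.
Proof. by rewrite -scaleN1r gfun_line mulN1r. Qed.

Lemma gvec_ge0 tau k : 0 <= tau <= 1 -> 0 <= gvec d tau k 0.
Proof.
by move=> /andP[t0 t1]; rewrite mxE !mulr_ge0 ?exprn_ge0// subr_ge0.
Qed.

Lemma sum_gvec tau : \sum_k gvec d tau k 0 = 1.
Proof.
transitivity (((1 - tau) + tau) ^+ d); last by rewrite subrK expr1n.
rewrite exprDn; apply: eq_bigr => k _.
by rewrite mxE -mulrA mulr_natl.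
Qed.

Lemma gfun_const i tau : gfun i (const_mx 1 : 'cV[R]_(d * m).+1) tau = - 1.
Proof.
rewrite /gfun dotE -[in RHS](sum_gvec tau); congr (- _); apply: eq_bigr => k _.
by rewrite !mxE /coef mxE mulr1.
Qed.

(** On [[0, 1]] the entries of [gvec] are convex weights, so the value is bounded by the largest
    coefficient. By linearity, [gfun] is thus 1-Lipschitz in [b] for the Euclidean norm. *)
Lemma sqr_gfun_le i b tau : 0 <= tau <= 1 -> gfun i b tau ^+ 2 <= sqnorm2 b.
Proof.
move=> t01; pose s := Num.sqrt (sqnorm2 b).
have s2 : s ^+ 2 = sqnorm2 b by rewrite sqr_sqrtr// sqnorm2_ge0.
have s0 : 0 <= s by exact: sqrtr_ge0.
rewrite -s2 -real_normK ?num_real// ler_pXn2r ?nnegrE//.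
rewrite /gfun normrN dotE; apply: le_trans (ler_norm_sum _ _ _) _.
rewrite -[leRHS]mul1r -(sum_gvec tau) mulr_suml; apply: ler_sum => k _.
rewrite normrM ger0_norm ?gvec_ge0// ler_wpM2l ?gvec_ge0//.
rewrite -(ler_pXn2r (ltn0Sn 1)) ?nnegrE// real_normK ?num_real// s2 mxE.
exact: sqr_coord_le_sqnorm2.
Qed.

Lemma gfun_le_phi i b tau : 0 <= tau <= 1 -> gfun i b tau <= phi i b.
Proof.
move=> t01; apply: sup_upper_bound; last by exists tau => //=; rewrite in_itv.
split; first by exists (gfun i b tau); exists tau => //=; rewrite in_itv.
exists (1 + sqnorm2 b) => _ [s /= + <-]; rewrite in_itv /= => s01.
by have := sqr_gfun_le i b s01; have := sqr_ge0 (gfun i b s - 1); nra.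
Qed.

Lemma feasible_line (H : 'M[R]_(2 * m - 2, (d * m).+1)) (T : nat -> set R) b z t :
  feasible H T b -> feasible H T z -> 0 < t <= 1 ->
  feasible H T (b + t *: (z - b)).
Proof.
move=> [bT Hb] [zT Hz] /andP[t0 t1]; split; last first.
  rewrite /kernel_space /= mulmxDr -scalemxAr mulmxBr.
  by rewrite Hb Hz subrr scaler0 addr0.
move=> i tau im Ti; rewrite -gfun_le0 gfun_line gfunB.
by have := bT i tau im Ti; have := zT i tau im Ti; rewrite -!gfun_le0; nra.
Qed.

Lemma feasible_sub (H : 'M[R]_(2 * m - 2, (d * m).+1)) (T T' : nat -> set R) b :
  (forall i, (1 <= i <= m)%N -> T' i `<=` T i) ->
  feasible H T b -> feasible H T' b.
Proof.
by move=> TT [bT Hb]; split => // i tau im T'i; apply: bT => //; exact: TT.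
Qed.

End constraints.

(** * Convergence of the cutting planes *)

Lemma exists_max_piece (R : realType) (F : nat -> R) (m : nat) : (1 <= m)%N ->
  exists2 j, (1 <= j <= m)%N & forall i, (1 <= i <= m)%N -> F i <= F j.
Proof.
elim: m => // m IH _; case: m IH => [|m] IH.
  by exists 1%N => // i; rewrite -eqn_leq => /eqP <-.
have [//|j /andP[j1 jm] jmax] := IH.
have [jF|Fj] := leP (F j) (F m.+2).
  exists m.+2; rewrite ?leqnn // => i /andP[i1].
  rewrite leq_eqVlt => /orP[/eqP->//|im]; apply: le_trans jF.
  by apply: jmax; rewrite i1.
exists j; first by rewrite j1 leqW.
move=> i /andP[i1]; rewrite leq_eqVlt => /orP[/eqP->|im]; first exact: ltW.
by apply: jmax; rewrite i1.
Qed.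

(** Nonnegativity of [a'] forces [a <= 1]; then [r * a' <= r * a * (1 - a) <= 1 - a], and adding
    [a' <= a] gives the bound. *)
Lemma harmonic_decay_step (R : realType) (a a' : R) (r : nat) :
  0 <= a -> 0 <= a' -> a' <= a - a ^+ 2 -> r%:R * a <= 1 -> r.+1%:R * a' <= 1.
Proof.
move=> a0 a'0 aa' ra.
have r0 : 0 <= r%:R :> R by [].
have a1 : a <= 1 by rewrite leNgt; apply/negP => a1; nra.
have h : r%:R * a' <= r%:R * (a - a ^+ 2) by rewrite ler_wpM2l.
have h2 : r%:R * a * (1 - a) <= 1 * (1 - a) by rewrite ler_wpM2r// subr_ge0.
by rewrite -natr1; nra.
Qed.

Section cuts_theory.
Variables (R : realType) (m d : nat) (eps : R).
Variables (b : nat -> 'cV[R]_(d * m).+1) (tau : nat -> nat -> R).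

Lemma generatedW r : generated eps b tau r.+1 -> generated eps b tau r.
Proof. by move=> gen q qr; apply: gen; exact: ltnW. Qed.

Lemma cutsS r i : cuts eps b tau r i `<=` cuts eps b tau r.+1 i.
Proof. by move=> t /= ct; case: ifP => // _; left. Qed.

Lemma cuts_new r i : eps < gfun i (b r) (tau i r) ->
  cuts eps b tau r.+1 i (tau i r).
Proof. by move=> /= ->; right. Qed.

(** Cuts at points of [[0, 1]] are constraints of the full problem, so each quadratic program
    relaxes it. *)
Lemma cuts_unit (f : 'cV[R]_(d * m).+1 -> R) (H : 'M[R]_(2 * m - 2, (d * m).+1))
    r i : cutting_plane_run f H eps b tau -> generated eps b tau r ->
  (1 <= i <= m)%N -> cuts eps b tau r i `<=` [set` `[0, 1]].
Proof.
move=> hrun + im; elim: r => [_|r IH gen]; first exact: sub0set.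
have [_ t01] := hrun r (generatedW gen).
move=> t /=; case: ifP => _; last exact: IH (generatedW gen) _.
by move=> [|->]; [exact: IH (generatedW gen) _|rewrite in_itv /= t01].
Qed.

End cuts_theory.

Theorem theorem3 (R : realType) (m d n : nat)
  (hm : (1 <= m)%N) (hd : (3 <= d)%N) (hn : (1 <= n)%N)
  (xi : nat -> R) (hxi : forall i : nat, (i < m)%N -> xi i < xi i.+1)
  (x : 'I_n.+1 -> R) (hx : forall j k : 'I_n.+1, (j < k)%N -> x j < x k)
  (hx0 : xi 0%N <= x ord0) (hxn : x ord_max <= xi m)
  (y : 'cV[R]_n.+1) (hy : forall j : 'I_n.+1, 0 <= y j 0)
  (lambda : R) (hlambda : 0 < lambda)
  (A : 'M[R]_(n.+1, (d * m).+1)) (hA : is_evaluation_mx xi x A)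
  (Q : 'M[R]_((d * m).+1)) (hQ : is_roughness_mx xi Q)
  (H : 'M[R]_(2 * m - 2, (d * m).+1)) (hH : is_smoothness_mx xi H)
  (P : 'M[R]_((d * m).+1)) (hP : is_orth_projection_mx (kernel_space H) P)
  (gamma : R)
  (hgamma : is_smallest_pos_eigenvalue (hessian_on_kernel A Q lambda P) gamma)
  (bstar : 'cV[R]_(d * m).+1)
  (hbstar : is_minimizer (objective y A Q lambda)
              (feasible H (fun _ : nat => [set` `[0, 1]])) bstar)
  (eps : R) (heps : 0 <= eps)
  (b : nat -> 'cV[R]_(d * m).+1) (tau : nat -> nat -> R)
  (hrun : cutting_plane_run (objective y A Q lambda) H eps b tau) :
  (forall r : nat, generated eps b tau r ->
     sqnorm2 (bstar - b r) <=
       2 / gamma * (objective y A Q lambda bstar - objective y A Q lambda (b r)))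
  /\
  ((exists delta : R, 0 <= delta < 1 /\
      forall r : nat, generated eps b tau r ->
      forall i : nat, (1 <= i <= m)%N ->
        phi i (b r) - delta * `| phi i (b r) | <= gfun i (b r) (tau i r)
          <= phi i (b r)) ->
   exists C : R, 0 <= C /\
     forall r : nat, (1 <= r)%N -> generated eps b tau r ->
       sqnorm2 (bstar - b r) <= C / r%:R).
Proof.
pose f := objective y A Q lambda; pose q := objective_quad A Q lambda.
have d0 : (0 < d)%N by exact: leq_trans hd.
have [Qsym Qpos _] := hQ; have [gamma0 _ _] := hgamma.
have qpos w : H *m w = 0 -> w != 0 -> 0 < q w.
  move=> Hw w0; rewrite lt_neqAle addr_ge0 ?sqnorm2_ge0 ?mulr_ge0 ?(ltW hlambda)//.
  rewrite andbT eq_sym; apply: contra_neq w0 => /eqP.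
  rewrite paddr_eq0 ?sqnorm2_ge0 ?mulr_ge0 ?(ltW hlambda)// mulf_eq0.
  rewrite (gt_eqF hlambda) /= => /andP[/eqP Aw /eqP Qw].
  exact: spline_definite hm d0 hn hxi hx hx0 hxn hA hQ hH Hw (sqnorm2_eq0 Aw) Qw.
have qge w : H *m w = 0 -> gamma / 2 * sqnorm2 w <= q w.
  by move=> Hw; exact: (smallest_eigenvalue_le_quad Qsym hP).
have [[bT Hbstar] bmin] := hbstar.
have feas r : generated eps b tau r -> feasible H (cuts eps b tau r) bstar.
  move=> gen; apply: feasible_sub (conj bT Hbstar) => i im.
  exact: cuts_unit hrun gen im.
have growth r z : generated eps b tau r -> feasible H (cuts eps b tau r) z ->
    gamma / 2 * sqnorm2 (z - b r) <= f z - f (b r).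
  move=> gen Sz; have [rmin _] := hrun r gen; have [Sb _] := rmin.
  have [_ Hb] := Sb; have [_ Hz] := Sz.
  have Hzb : H *m (z - b r) = 0 by rewrite mulmxBr Hb Hz subrr.
  apply: le_trans (qge _ Hzb) _; rewrite lerBrDl.
  by apply: minimizer_growth Qsym rmin _ => t; exact: feasible_line.
have part1 r : generated eps b tau r ->
    sqnorm2 (bstar - b r) <= 2 / gamma * (f bstar - f (b r)).
  move=> gen; have := growth r bstar gen (feas r gen).
  by rewrite -ler_pdivlMl ?divr_gt0// invf_div.
split=> // -[delta [/andP[delta0 delta1] hdelta]].
have f_ge0 w : 0 <= f w by apply: objective_ge0 => //; exact: ltW.
pose D r := f bstar - f (b r).
have D_ge0 r : generated eps b tau r -> 0 <= D r.
  move=> gen; apply: le_trans (growth r bstar gen (feas r gen)).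
  by rewrite mulr_ge0 ?sqnorm2_ge0// divr_ge0// ltW.
pose e : 'cV[R]_(d * m).+1 := const_mx 1.
have He : H *m e = 0 by exact: smoothness_mx_const hH.
(* As [f] is nonnegative, the first claim bounds every squared distance from [b r] to [bstar] by
   [B]. *)
pose B := 2 / gamma * f bstar.
have B0 : 0 <= B by rewrite mulr_ge0 ?divr_ge0 ?(ltW gamma0).
have [L L0 Lle] : exists2 L, 0 <= L & forall r, generated eps b tau r ->
    objective_slope y A Q lambda (b r) e <= L.
  (* The Hessian of [f] applied to [e]; pairing it with [bstar - b r] gives the change of slope
     between the two points. *)
  pose u := 2 *: (A^T *m (A *m e) + lambda *: (Q *m e)).
  exists (`|objective_slope y A Q lambda bstar e| + (\sum_k `|u k 0|) * (1 + B)).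
    by rewrite addr_ge0// mulr_ge0 ?sumr_ge0// addr_ge0.
  move=> r gen.
  have -> : objective_slope y A Q lambda (b r) e =
      objective_slope y A Q lambda bstar e - dot u (bstar - b r).
    rewrite /objective_slope /u dotZl dotDl !dotBr !dotZl.
    have E z : dot (A^T *m (A *m e)) z = dot (A *m e) (A *m z).
      by rewrite /dot trmx_mul trmxK mulmxA.
    by rewrite !E; ring.
  apply: lerD; first exact: ler_norm.
  apply: le_trans (ler_norm _) _; rewrite normrN.
  apply: le_trans (norm_dot_le _ _) _; rewrite ler_wpM2l ?sumr_ge0// lerD2l.
  apply: le_trans (part1 r gen) _; rewrite ler_wpM2l ?divr_ge0 ?(ltW gamma0)//.
  by rewrite lerBlDr lerDl.
have delta1' : 0 < 1 - delta by rewrite subr_gt0.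
have qe0 : 0 <= q e.
  by rewrite addr_ge0 ?sqnorm2_ge0 ?mulr_ge0 ?(ltW hlambda).
(* Moving by [Phi *: e] raises [f] by at most [Phi * L + Phi ^+ 2 * q e], where
   [Phi <= (1 + B) / (1 - delta)]; the summand 1 makes [K] positive. *)
pose K := 1 + L + (1 + B) / (1 - delta) * q e.
have K0 : 0 < K.
  rewrite /K -addrA ltr_pwDl// addr_ge0// mulr_ge0//.
  by rewrite divr_ge0 ?(ltW delta1')// addr_ge0.
(* Chosen so that [gamma / 2 * g ^+ 2 = kappa * (K * Phi) ^+ 2] when [g = (1 - delta) * Phi]. *)
pose kappa := gamma / 2 * (1 - delta) ^+ 2 / K ^+ 2.
have kappa0 : 0 < kappa by rewrite divr_gt0 ?exprn_gt0// mulr_gt0 ?exprn_gt0// divr_gt0.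
have step r : generated eps b tau r.+1 -> D r.+1 <= D r - kappa * D r ^+ 2.
  move=> gen1; have gen := generatedW gen1.
  have [j jm jmax] := exists_max_piece (fun i => gfun i (b r) (tau i r)) hm.
  have epsj : eps < gfun j (b r) (tau j r).
    have [i im ei] := gen1 r (ltnSn r).
    by apply: lt_le_trans ei _; exact: jmax.
  have [[_ t01] [[S1 Hb1] _]] := (hrun r gen, (hrun _ gen1).1).
  have [[[_ Hb] _] _] := hrun r gen.
  set g := gfun j (b r) (tau j r) in epsj.
  have g0 : 0 < g by exact: le_lt_trans epsj.
  have inc : gamma / 2 * sqnorm2 (b r.+1 - b r) <= f (b r.+1) - f (b r).
    apply: growth => //; apply: feasible_sub (conj S1 Hb1) => i _; exact: cutsS.
  (* The new cut makes the constraint function nonpositive at [b r.+1], while it equals [g] at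
     [b r]; the Lipschitz bound turns this drop into distance. *)
  have gle : g ^+ 2 <= sqnorm2 (b r.+1 - b r).
    apply: le_trans (sqr_gfun_le j (b r.+1 - b r) (t01 j jm)).
    have := S1 j _ jm (cuts_new epsj); rewrite -gfun_le0 gfunB -/g => h.
    by rewrite -subr_ge0 subr_sqr; nra.
  have D1 := D_ge0 _ gen1.
  have gB : g <= 1 + B.
    have : g ^+ 2 <= B.
      apply: le_trans gle _.
      have : sqnorm2 (b r.+1 - b r) <= 2 / gamma * (f (b r.+1) - f (b r)).
        by move: inc; rewrite -ler_pdivlMl ?divr_gt0// invf_div.
      move=> /le_trans; apply; rewrite ler_wpM2l ?divr_ge0 ?(ltW gamma0)//.
      by move: D1; rewrite /D; have := f_ge0 (b r); lra.
    by have := sqr_ge0 (g - 1); nra.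
  pose Phi := g / (1 - delta).
  have Phi0 : 0 < Phi by rewrite divr_gt0.
  (* For positive [phi i (b r)] the accuracy assumption reads [(1 - delta) * phi i (b r) <= gfun i
     (b r) (tau i r)], and the right side is at most [g]. *)
  have phi_le i : (1 <= i <= m)%N -> phi i (b r) <= Phi.
    move=> im; have [p0|p0] := leP (phi i (b r)) 0.
      exact: le_trans p0 (ltW Phi0).
    rewrite ler_pdivlMr//; apply: le_trans (jmax i im).
    have /andP[+ _] := hdelta r gen i im.
    by rewrite gtr0_norm//; apply: le_trans; rewrite mulrBr mulr1 [delta * _]mulrC.
  have fPhi : f bstar <= f (b r + Phi *: e).
    apply: bmin; split; last first.
      by rewrite /kernel_space /= mulmxDr -scalemxAr He Hb scaler0 addr0.
    move=> i t im; rewrite /= in_itv /= => tt.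
    rewrite -gfun_le0 gfun_line gfun_const mulrN1 subr_le0.
    by apply: le_trans (phi_le i im); exact: gfun_le_phi.
  have DPhi : D r <= K * Phi.
    move: fPhi; rewrite /f objective_line// -/f -/q => fPhi.
    have h1 := Lle r gen.
    have h2 : Phi <= (1 + B) / (1 - delta) by rewrite ler_wpM2r// invr_ge0 ltW.
    have h3 : Phi * objective_slope y A Q lambda (b r) e <= Phi * L.
      by rewrite ler_wpM2l// ltW.
    have h4 : Phi * (Phi * q e) <= Phi * ((1 + B) / (1 - delta) * q e).
      by rewrite ler_wpM2l ?(ltW Phi0)// ler_wpM2r.
    rewrite /D /K; lra.
  have DD : kappa * D r ^+ 2 <= gamma / 2 * g ^+ 2.
    have -> : gamma / 2 * g ^+ 2 = kappa * (K * Phi) ^+ 2.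
      by rewrite /kappa /Phi; field; rewrite !gt_eqF.
    rewrite ler_wpM2l ?(ltW kappa0)// ler_pXn2r ?nnegrE ?D_ge0//.
    by rewrite mulr_ge0 ?(ltW K0) ?(ltW Phi0).
  have : gamma / 2 * g ^+ 2 <= f (b r.+1) - f (b r).
    by apply: le_trans inc; rewrite ler_wpM2l ?divr_ge0 ?(ltW gamma0).
  by rewrite /D => h; move: DD; rewrite /D; lra.
(* Scaling by [kappa] normalizes the recursion to [a' <= a - a ^+ 2] with [a = kappa * D r]. *)
have rate r : generated eps b tau r -> r%:R * (kappa * D r) <= 1.
  elim: r => [|r IH] gen; first by rewrite mul0r.
  have genr := generatedW gen.
  apply: harmonic_decay_step (IH genr).
  - by rewrite mulr_ge0 ?D_ge0// ltW.
  - by rewrite mulr_ge0 ?D_ge0// ltW.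
  - rewrite exprMn expr2 -mulrA -mulrBr ler_wpM2l ?(ltW kappa0)//.
    exact: step.
exists (2 / gamma / kappa); split.
  by rewrite mulr_ge0 ?divr_ge0 ?invr_ge0 ?(ltW gamma0) ?(ltW kappa0).
move=> r r1 gen; have r0 : 0 < r%:R :> R by rewrite ltr0n.
apply: le_trans (part1 r gen) _.
rewrite -[leRHS]mulrA ler_wpM2l ?divr_ge0 ?(ltW gamma0)// -invfM -[leRHS]mul1r.
rewrite ler_pdivlMr; last exact: mulr_gt0.
by rewrite mulrC [kappa * _]mulrC -mulrA; exact: rate.
Qed.
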